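(* Let $q$ be a prime power and $k \geq 2$ an integer. There exists a constant $n_0(k,q)$ such that for all $n \geq n_0(k,q)$, every set of type $(\alpha,\beta)_{k-1}$ in $\mathrm{PG}(n-1,q)$ has either $\alpha = 0$ or $\beta = \frac{q^k-1}{q-1}$, and is either a single point, a hyperplane, the complement of a single point, or the complement of a hyperplane.
   Context: $\mathrm{PG}(n-1,q)$ is the projective geometry of an $n$-dimensional vector space $V$ over $\mathbb{F}_q$; its points are the $1$-dimensional subspaces of $V$, hyperplanes are $(n-1)$-dimensional subspaces, and a ''$k$-space'' means a $k$-dimensional subspace of $V$ (vector-space dimension). For integers $\alpha<\beta$, a set of type $(\alpha,\beta)_{k-1}$ is a set $\mathcal{P}$ of points such that every $k$-space contains either exactly $\alpha$ or exactly $\beta$ points of $\mathcal{P}$. Complements are taken within the set of all points.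
   Formalization: The empty set and the set of all points are excluded: under the literal definition they are sets of type (0,β) and (α,(q^k-1)/(q-1)) for every admissible β, α, yet they are not among the four listed sets. *)

(* Defs.v *)
From HB Require Import structures.
From mathcomp Require Import all_boot all_order all_algebra all_field.

Set Implicit Arguments.
Unset Strict Implicit.
Unset Printing Implicit Defensive.

(* The library does not register the finiteness of {vspace V} over a finite   *)
(* field, which {set {vspace V}} and cardinals need.                          *)
HB.instance Definition _ (F : finFieldType) (V : vectType F) :
    isCountable {vspace V} :=
  CanIsCountable (@VectorInternalTheory.vs2mxK F V).
HB.instance Definition _ (F : finFieldType) (V : vectType F) :
    isFinite {vspace V} :=
  CanIsFinite (@VectorInternalTheory.vs2mxK F V).

Definition prime_power (q : nat) : Prop :=
  exists p e : nat, [/\ prime p, (0 < e)%N & q = (p ^ e)%N].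

Section ProjectiveGeometry.

Variables (F : finFieldType) (V : vectType F).
Implicit Types (U H : {vspace V}) (P : {set {vspace V}}).

Definition pg_points : {set {vspace V}} := [set p | \dim p == 1%N].

Definition points_of U : {set {vspace V}} := [set p in pg_points | (p <= U)%VS].

Definition hyperplane H : bool := (\dim H).+1 == \dim {:V}.

(* k is a vector space dimension. Neither value is required to be attained, so *)
(* the empty set and the set of all points are sets of some type.              *)
Definition set_of_type (k : nat) (alpha beta : int) P : Prop :=
  [/\ (alpha < beta)%R,
      P \subset pg_points
    & forall U, \dim U = k ->
        #|P :&: points_of U|%:Z%R = alpha \/ #|P :&: points_of U|%:Z%R = beta].

End ProjectiveGeometry.

Arguments pg_points {F} V.

(* Main.v *)
Require Import Defs.
From HB Require Import structures.
From mathcomp Require Import all_boot all_order all_algebra all_field.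
From mathcomp Require Import zify.

Set Implicit Arguments.
Unset Strict Implicit.
Unset Printing Implicit Defensive.

Import GRing.Theory passmx.
Local Open Scope ring_scope.

(** Colour the points by membership in [P].  By Ramsey's theorem for points of
    projective spaces, some k-space contains no point of [P] or only points of
    [P]; taking complements we may assume the former, so that [alpha = 0].
    A set meeting every k-space in 0 or [beta] points also meets every
    (k-1)-space in 0 or a constant number of points, since counting [P] over
    the k-spaces through a (k-1)-space that meets [P] determines the size of
    that intersection.  Going down to lines, every line meets [P] in 0 or
    [d + 1] points.  Unless [d] is 0, q - 1 or q, every plane meeting [P]
    does so in a maximal arc, so [d + 1] divides a power of q; the planes
    through an external line then show that the size [d (q + 1) + 1] of
    such an arc also divides a power of q, which is impossible.  The three
    remaining values of [d] give a point, the complement of a hyperplane, and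
    the set of all points. *)

(** * Ramsey theorem for points *)

(** A van der Waerden theorem for lines, by induction on the number [s] of parameters whose colour
    must agree with that at [t0]. With [T] enumerating [F] it yields a monochromatic affine line. *)
Lemma line_ramsey (q s r : nat) : exists N : nat,
  forall (F : finFieldType) (C : finType) (t0 : F) (T : seq F)
    (c : 'rV[F]_N -> C), #|F| = q -> #|C| = r -> size T = s ->
  exists x d, d != 0 /\ {in T, forall t, c (x + t *: d) = c (x + t0 *: d)}.
Proof.
elim: s r => [|s IHs] r.
  exists 1%N => F C t0 T c _ _ /size0nil->.
  exists 0, (const_mx 1); split=> //.
  by apply/eqP=> /rowP/(_ 0)/eqP; rewrite !mxE oner_eq0.
(* Colour focusing: the [j] lines with directions in [D] are monochromatic on
   [T] in pairwise distinct colours, and they all pass through [f] at the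
   parameter [ts]. *)
suff focus j : exists N : nat,
  forall (F : finFieldType) (C : finType) (t0 ts : F) (T : seq F)
    (c : 'rV[F]_N -> C), #|F| = q -> #|C| = r -> size T = s ->
  (exists x d, d != 0 /\
     {in ts :: T, forall t, c (x + t *: d) = c (x + t0 *: d)}) \/
  exists f (D : seq 'rV[F]_N),
    [/\ size D = j, uniq [seq c (f + (t0 - ts) *: d) | d <- D]
      & {in D, forall d, d != 0 /\
         {in T, forall t, c (f + (t - ts) *: d) = c (f + (t0 - ts) *: d)}}].
  have [N HN] := focus r.+1; exists N => F C t0 [//|ts T] c cF cC [sT].
  have [//|[f [D [sD uD _]]]] := HN F C t0 ts T c cF cC sT.
  have := max_card (mem [seq c (f + (t0 - ts) *: d) | d <- D]).
  by rewrite (card_uniqP uD) size_map sD cC ltnn.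
elim: j => [|j [N1 IHj]].
  by exists 0%N => F C t0 ts T c _ _ _; right; exists 0, [::].
(* A vector [y] of the second block of coordinates is coloured by the whole colouring it induces on
   the first block; there are [r ^ (q ^ N1)] of these. *)
have [N2 HN2] := IHs (r ^ (q ^ N1))%N.
exists (N1 + N2)%N => F C t0 ts T c cF cC sT.
pose g (y : 'rV[F]_N2) := [ffun u : 'rV[F]_N1 => c (row_mx u y)].
have cC' : #|{ffun 'rV[F]_N1 -> C}| = (r ^ (q ^ N1))%N.
  by rewrite card_ffun cC card_mx cF mul1n.
have [y [d [d0 Hd]]] := HN2 F _ t0 T g cF cC' sT.
have {}Hd t u : t \in T ->
    c (row_mx u (y + t *: d)) = c (row_mx u (y + t0 *: d)).
  by move/Hd/ffunP/(_ u); rewrite !ffunE.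
have row0 n1 n2 (a : 'rV[F]_n1) (b : 'rV_n2) : row_mx a b = 0 -> a = 0 /\ b = 0.
  by rewrite -row_mx0 => /eq_row_mx.
pose c1 u := c (row_mx u (y + t0 *: d)).
have split_row t f e : row_mx f (y + ts *: d) + (t - ts) *: row_mx e d
    = row_mx (f + (t - ts) *: e) (y + t *: d).
  by rewrite scale_row_mx add_row_mx -addrA -scalerDl [ts + _]addrC subrK.
have mono f e : e != 0 ->
    {in ts :: T, forall t, c1 (f + (t - ts) *: e) = c1 (f + (t0 - ts) *: e)} ->
    exists x d', d' != 0 /\
      {in ts :: T, forall t, c (x + t *: d') = c (x + t0 *: d')}.
  move=> e0 He; exists (row_mx (f - ts *: e) (y + t0 *: d)), (row_mx e 0).
  split=> [|t /He]; first by apply: contraNneq e0 => /row0[->].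
  have E t' : f - ts *: e + t' *: e = f + (t' - ts) *: e.
    by rewrite scalerBl addrAC addrA.
  by rewrite /c1 !scale_row_mx !add_row_mx !scaler0 !addr0 !E.
have [|[f [D [sD uD HD]]]] := IHj F C t0 ts T c1 cF cC sT.
  move=> [x [e [e0 He]]]; left; apply: (mono (x + ts *: e) e e0) => t /He.
  have E t' : x + ts *: e + (t' - ts) *: e = x + t' *: e.
    by rewrite -addrA -scalerDl [ts + _]addrC subrK.
  by rewrite !E.
(* If [c1 f] is already the colour of a focused line, that line is monochromatic on [ts :: T].
   Otherwise the direction [(0, d)] contributes the new colour [c1 f], and each old direction [e]
   becomes [(e, d)]. *)
case: (boolP (c1 f \in [seq c1 (f + (t0 - ts) *: e) | e <- D])) =>
    [/mapP[e eD fe]|nf].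
  left; have [e0 He] := HD e eD; apply: (mono f e e0) => t.
  rewrite inE => /predU1P[->|/He->//].
  by rewrite subrr scale0r addr0.
right; exists (row_mx f (y + ts *: d)).
exists (row_mx 0 d :: [seq row_mx e d | e <- D]).
have rd0 e : row_mx e d != 0 :> 'rV[F]_(N1 + N2).
  by apply: contraNneq d0 => /row0[_ ->].
split.
- by rewrite /= size_map sD.
- rewrite map_cons split_row scaler0 addr0 -map_comp.
  rewrite (@eq_map _ _ _ (fun e => c1 (f + (t0 - ts) *: e))) /= ?nf // => e /=.
  by rewrite split_row.
move=> e'; rewrite inE => /predU1P[->|/mapP[e eD ->]]; split=> // t tT.
  by rewrite !split_row !scaler0 !addr0 Hd.
by rewrite !split_row Hd //; have [_ /(_ t tT)] := HD e eD.
Qed.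

(** Induction on [m]: some line of the second block induces one and the same colouring of the first
    block at all its points, so a monochromatic affine [m]-space found there can be extended by the
    direction of that line. *)
Lemma affine_ramsey (q m r : nat) : exists N : nat,
  forall (F : finFieldType) (C : finType) (c : 'rV[F]_N -> C),
    #|F| = q -> #|C| = r ->
  exists x (M : 'M[F]_(m, N)), row_free M /\ forall w, c (x + w *m M) = c x.
Proof.
elim: m r => [|m IHm] r.
  exists 0%N => F C c _ _; exists 0, 0; split=> [|w].
    by rewrite /row_free mxrank0.
  by congr c; apply/matrixP=> i [].
have [N1 HN1] := IHm r.
have [N2 HN2] := line_ramsey q q (r ^ (q ^ N1))%N.
exists (N1 + N2)%N => F C c cF cC.
pose g (y : 'rV[F]_N2) := [ffun u : 'rV[F]_N1 => c (row_mx u y)].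
have cC' : #|{ffun 'rV[F]_N1 -> C}| = (r ^ (q ^ N1))%N.
  by rewrite card_ffun cC card_mx cF mul1n.
have [|y [d [d0 Hd]]] := HN2 F _ 0 (enum F) g cF cC'; first by rewrite -cardE.
have {}Hd t u : c (row_mx u (y + t *: d)) = c (row_mx u y).
  by have /ffunP/(_ u) := Hd t (mem_enum F t); rewrite !ffunE scale0r addr0.
have [x [M [fM HM]]] := HN1 F C (fun u => c (row_mx u y)) cF cC.
exists (row_mx x y).
have wE (w : 'rV[F]_(1 + m)) : w *m block_mx 0 d M 0 =
    row_mx (rsubmx w *m M) (lsubmx w 0 0 *: d).
  rewrite -{1}(hsubmxK w) mul_row_block !mulmx0 add0r addr0.
  by rewrite {1}[lsubmx w]mx11_scalar mul_scalar_mx.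
exists (block_mx 0 d M 0 : 'M_(1 + m, N1 + N2)); split=> [|w].
  apply: (@inj_row_free _ (1 + m)) => w; rewrite wE -row_mx0.
  case/eq_row_mx=> /eqP w1 /eqP; rewrite scaler_eq0 (negPf d0) orbF => /eqP w2.
  rewrite -(hsubmxK w) [lsubmx w]mx11_scalar w2.
  move: w1; rewrite mulmx_free_eq0 // => /eqP->.
  by rewrite -scalemx1 scale0r row_mx0.
by rewrite wE add_row_mx Hd HM.
Qed.

(** Off-diagonal Ramsey induction on [e true + e false]: take a monochromatic affine space of colour
    [b], then apply induction to its points at infinity with the target for [b] lowered by one. A
    subspace of colour [b] found there is joined to an affine point. *)
Lemma point_ramsey (q : nat) (e : bool -> nat) : exists N : nat,
  forall (F : finFieldType) (n : nat) (c : 'rV[F]_n -> bool),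
    #|F| = q -> (N <= n)%N -> (forall s w, s != 0 -> c (s *: w) = c w) ->
  exists b (M : 'M[F]_(e b, n)),
    row_free M /\ forall w, w != 0 -> c (w *m M) = b.
Proof.
have [s] := ubnP (e true + e false)%N; elim: s e => // s IHs e les.
have [/existsP[b /eqP eb]|/existsPn e_gt0] := boolP [exists b, e b == 0%N].
  exists 0%N => F n c _ _ _; exists b, 0; rewrite eb; split=> [|w].
    by rewrite /row_free mxrank0.
  by case/eqP; apply/rowP=> -[].
pose e' b b' := if b' == b then (e b').-1 else e b'.
have IH b : exists N : nat, forall (F : finFieldType) n (c : 'rV[F]_n -> bool),
    #|F| = q -> (N <= n)%N -> (forall s w, s != 0 -> c (s *: w) = c w) ->
  exists b' (M : 'M[F]_(e' b b', n)),
    row_free M /\ forall w, w != 0 -> c (w *m M) = b'.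
  apply: IHs; move: (e_gt0 true) (e_gt0 false) les; rewrite /e'.
  by case: b; case: (e true) => //; case: (e false) => // m n;
    rewrite /= ?addnS.
have [N1 HN1] := IH true; have [N0 HN0] := IH false.
have [N HN] := affine_ramsey q (maxn N1 N0) #|{: bool}|.
exists (1 + N)%N => F n c cF leNn cs.
pose E : 'M[F]_(1 + N, n) := pid_mx (1 + N).
have fE : row_free E by rewrite /row_free rank_pid_mx.
have [x [M [fM HM]]] := HN F _ (fun h => c (row_mx 1 h *m E)) cF erefl.
pose b := c (row_mx 1 x *m E); rewrite -/b in HM.
(* [c'] colours the directions of the affine space found in the chart [(1, h)], that is, its points
   at infinity. *)
pose c' w := c (row_mx (0 : 'rV_1) (w *m M) *m E).
have c's t w : t != 0 -> c' (t *: w) = c' w.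
  by move=> t0;
    rewrite /c' -[RHS](cs t) // scalemxAl scale_row_mx scaler0 scalemxAl.
have [b' [M' [fM' HM']]] : exists b' (M' : 'M[F]_(e' b b', maxn N1 N0)),
    row_free M' /\ forall w, w != 0 -> c' (w *m M') = b'.
  by case: {+}b; [apply: HN1|apply: HN0] => //; rewrite ?leq_maxl ?leq_maxr.
exists b'; move: M' fM' HM'; rewrite /e'; case: eqP => [->|_] M' fM' HM'.
  have eb : e b = (1 + (e b).-1)%N by rewrite add1n prednK // lt0n e_gt0.
  rewrite eb.
  (* A vector with nonzero first coordinate can be scaled to first coordinate 1, where it lies in
     the monochromatic affine space; the others are directions controlled by [M']. *)
  pose B : 'M[F]_(1 + (e b).-1, 1 + N) := block_mx 1 x 0 (M' *m M).
  have BE (w : 'rV_(1 + (e b).-1)) : w *m B = row_mx (lsubmx w)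
      (lsubmx w *m x + rsubmx w *m M' *m M).
    by rewrite -{1}(hsubmxK w) mul_row_block mulmx0 mulmx1 addr0 mulmxA.
  exists (B *m E); split=> [|w w0].
    apply: (@inj_row_free _ (1 + (e b).-1)) => w /eqP.
    rewrite mulmxA mulmx_free_eq0 // BE.
    rewrite -row_mx0 => /eqP/eq_row_mx[l0].
    rewrite l0 mul0mx add0r => /eqP; rewrite !mulmx_free_eq0 // => /eqP r0.
    by rewrite -(hsubmxK w) l0 r0 row_mx0.
  rewrite mulmxA BE; have [l0|l0] := eqVneq (lsubmx w) 0.
    rewrite l0 mul0mx add0r; apply: HM'; apply: contraNneq w0 => r0.
    by rewrite -(hsubmxK w) l0 r0 row_mx0.
  have [t tE] : exists t, lsubmx w = t *: 1.
    by exists (lsubmx w 0 0); rewrite scalemx1 -mx11_scalar.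
  have t0 : t != 0 by apply: contraNneq l0 => t0; rewrite tE t0 scale0r.
  rewrite tE -scalemxAl mul1mx.
  apply: etrans (HM (t^-1 *: (rsubmx w *m M')));
    rewrite -[RHS](cs t) // scalemxAl.
  by rewrite scale_row_mx scalerDr -scalemxAl scalerA divff ?scale1r.
exists (row_mx 0 (M' *m M) *m E); split=> [|w w0].
  apply: inj_row_free => w /eqP; rewrite mulmxA mulmx_free_eq0 //.
  rewrite mul_mx_row mulmx0 -row_mx0 => /eqP/eq_row_mx[_ /eqP].
  by rewrite mulmxA !mulmx_free_eq0 // => /eqP.
by rewrite mulmxA mul_mx_row mulmx0 mulmxA; apply: HM'.
Qed.

(** * Counting in cones *)

(* [1 + d * (q + 1)] is the size of a maximal arc of degree [d + 1] in a
   plane of order [q]; both it and [d + 1] would be powers of [p]. *)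
Lemma no_maximal_arc_type p e d : prime p -> (0 < d)%N -> (d.+1 < p ^ e)%N ->
  (1 + d * (p ^ e + 1) %| d * (p ^ e) ^ 4)%N ->
  ~~ (d.+1 %| p ^ e * (1 + d * (p ^ e + 1)))%N.
Proof.
move=> pp d0 ltq; set m := (1 + _)%N; set q := (p ^ e)%N in ltq *.
have mE : m = (d.+1 + d * q)%N by rewrite /m; lia.
have -> : (m %| d * q ^ 4)%N = (m %| q ^ 4)%N.
  by rewrite Gauss_dvdr // coprime_sym /m /coprime addnC mulnC gcdnMDl gcdn1.
rewrite -expnM => /(dvdn_pfactor _ _ pp)[j _ mj].
apply/negP; rewrite mE mulnDr (dvdn_addr _ (dvdn_mull _ (dvdnn _))).
rewrite mulnCA Gauss_dvdr ?coprimeSn // mulnn -expnM.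
case/(dvdn_pfactor _ _ pp)=> i _ di.
have p1 := prime_gt1 pp.
(* Here [d.+1 = p ^ i] and [m = p ^ j]. Once [i < e] and [i < j], the power [p ^ i.+1] divides both
   [m] and [d * q], hence also [d.+1], which is too small. *)
have ie : (i < e)%N by rewrite -(ltn_exp2l _ _ p1) -di.
have ij : (i < j)%N.
  rewrite -(ltn_exp2l _ _ p1) -di -mj mE -addn1 leq_add2l muln_gt0 d0.
  by rewrite expn_gt0 ltnW.
have : (p ^ i.+1 %| d.+1)%N.
  have pdq : (p ^ i.+1 %| d * q)%N by rewrite dvdn_mull // dvdn_exp2l.
  by rewrite -(dvdn_addl _ pdq) -mE mj dvdn_exp2l.
by move/(dvdn_leq (ltn0Sn d)); rewrite di leq_exp2l // ltnn.
Qed.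

Section ConeCounting.
Variables (F : finFieldType) (V : vectType F).
Local Notation fV := (finvect_type V).
Local Notation q := #|F|.
Implicit Types (x v a : fV) (U W : {vspace fV}).

Lemma dimv_addl W x : x \notin W -> \dim (W + <[x]>) = (\dim W).+1.
Proof.
move=> xW; rewrite dimv_disjoint_sum ?dim_vline.
  by case: eqP xW => [->|_]; rewrite ?mem0v ?addn1.
apply/eqP; rewrite -subv0; apply/subvP=> v /memv_capP[vW /vlineP[c vE]].
rewrite memv0 vE scaler_eq0; apply/orP; left; apply: contraNT xW => c0.
by rewrite -(scalerK c0 x) -vE memvZ.
Qed.

Lemma vspace_extend (W U : {vspace fV}) k : (W <= U)%VS ->
    (\dim W <= k <= \dim U)%N ->
  exists X : {vspace fV}, [/\ (W <= X)%VS, (X <= U)%VS & \dim X = k].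
Proof.
move=> sWU; elim: k => [|k IHk] /andP[].
  by rewrite leqn0 => /eqP W0 _; exists W.
rewrite leq_eqVlt => /predU1P[<- _|leWk ltkU]; first by exists W.
have [|X [sWX sXU dX]] := IHk; first by apply/andP; split=> //; apply: ltnW.
have /subvPn[x xU xX] : ~~ (U <= X)%VS.
  by apply/negP=> /dimvS; rewrite dX leqNgt ltkU.
exists (X + <[x]>)%VS; rewrite dimv_addl // dX; split=> //.
  by rewrite (subv_trans sWX) ?addvSl.
by rewrite subv_add sXU -memvE.
Qed.

Variable A : fV -> bool.
Hypotheses (A0 : ~~ A 0) (AZ : forall s v, s != 0 -> A (s *: v) = A v).

(** Counting vectors in cosets turns counting over a quotient space into sums over vectors. For [x]
    outside [W], each point of [W + <[x]>] not in [W] has exactly one representative in [x + W]. *)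
Definition cone_count x W := (\sum_(w in W) A (x + w)%R)%N.
Arguments cone_count x%_R W%_VS.
Local Notation cnt := cone_count.

Lemma cone_countD x w W : w \in W -> cnt (x + w) W = cnt x W.
Proof.
move=> wW; rewrite /cnt [RHS](reindex_inj (addrI w)) /=.
by apply: eq_big => [u|u _]; rewrite ?addrA // rpredDl.
Qed.

Lemma cone_countZ s x W : s != 0 -> cnt (s *: x) W = cnt x W.
Proof.
move=> s0; rewrite /cnt (reindex_inj (scalerI s0)) /=.
by apply: eq_big => [u|u _]; rewrite -?scalerDr ?AZ // rpredZeq (negPf s0).
Qed.

Lemma cone_count_line a : A a -> cnt 0 <[a]> = (q - 1)%N.
Proof.
move=> Aa; have a0 : a != 0 by apply: contraTneq Aa => ->.
rewrite /cnt (bigD1 0) ?mem0v //= addr0 (negPf A0) add0n.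
rewrite (eq_bigr (fun=> 1%N)) => [|w /andP[/vlineP[c ->] c0]]; last first.
  by rewrite add0r AZ ?Aa //; apply: contraNneq c0 => ->; rewrite scale0r.
have <- : #|<[a]>%VS| = q by rewrite card_vspace dim_vline a0 expn1.
rewrite sum1_card [in RHS](cardD1 0) mem0v addKn.
by apply: eq_card => w; rewrite !inE andbC.
Qed.

Lemma sum_cone_count x W U : (W <= U)%VS ->
  (\sum_(v in U) cnt (x + v) W = q ^ \dim W * cnt x U)%N.
Proof.
move=> sWU; rewrite exchange_big /= -card_vspace -sum_nat_const.
apply: eq_bigr => w wW; rewrite /cnt [RHS](reindex_inj (addIr w)) /=.
apply: eq_big => [u|u _]; last by rewrite addrA.
by rewrite rpredDr // (subvP sWU).
Qed.

Lemma cone_count_compl x W :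
  (cnt x W + #|[pred w in W | ~~ A (x + w)%R]| = q ^ \dim W)%N.
Proof.
rewrite -card_vspace -(cardID [pred w | A (x + w)] (mem W)); congr (_ + _)%N.
  rewrite /cone_count big_mkcond -sum1_card [RHS]big_mkcond;
    apply: eq_bigr => w _.
  by rewrite !inE andbC; case: (A _); case: (_ \in _).
by apply: eq_card => w; rewrite !inE andbC.
Qed.

Lemma sum_cone_count_out W U : (W <= U)%VS ->
  (\sum_(v in U | v \notin W) cnt v W + q ^ \dim W * cnt 0 W
    = q ^ \dim W * cnt 0 U)%N.
Proof.
move=> sWU; rewrite -(sum_cone_count 0 sWU) [RHS](bigID (mem W)) /= addnC.
congr (_ + _)%N; last by apply: eq_bigr => v; rewrite add0r.
rewrite -card_vspace -sum_nat_const.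
apply: eq_big => [v|v vW]; last by rewrite cone_countD.
by rewrite andb_idl //; apply/subvP: v.
Qed.

Lemma sum_out_const W U n : (W <= U)%VS ->
  (\sum_(v in U | v \notin W) n = (q ^ \dim U - q ^ \dim W) * n)%N.
Proof.
move=> sWU; rewrite sum_nat_const; congr (_ * _)%N.
rewrite -!card_vspace -[in RHS](cardID (mem W) (mem U)).
have -> : #|[predI U & W]| = #|W|.
  by apply: eq_card => v; rewrite !inE andb_idl //; apply/subvP: v.
by rewrite addKn; apply: eq_card => v; rewrite !inE andbC.
Qed.

Lemma q_gt1 : (1 < q)%N. Proof. exact: finNzRing_gt1. Qed.

(** The vectors outside [W] fill the [q - 1] cosets of the nonzero multiples of [x], and these have
    equal counts by homogeneity. *)
Lemma cone_count_addl x W : x \notin W ->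
  cnt 0 (W + <[x]>) = (cnt 0 W + (q - 1) * cnt x W)%N.
Proof.
move=> xW; have sW : (W <= W + <[x]>)%VS by apply: addvSl.
have := sum_cone_count_out sW.
rewrite (eq_bigr (fun=> cnt x W)) =>
    [|v /andP[/memv_addP[w wW [_ /vlineP[c ->] ->]]]].
  rewrite sum_out_const // dimv_addl // => E; apply/eqP.
  rewrite -(@eqn_pmul2l (q ^ \dim W)) ?expn_gt0 ?(ltnW q_gt1) // -E.
  by rewrite expnS -[X in (_ - X)%N]mul1n -mulnBl mulnDr addnC mulnA
     [((q - 1) * _)%N]mulnC.
rewrite rpredDl // addrC cone_countD // => nW.
by rewrite cone_countZ //; apply: contraNneq nW => ->; rewrite scale0r mem0v.
Qed.

(** * Descent from k-spaces to lines *)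

Definition meets U := [exists a in U, A a].

Definition const_on (k B : nat) :=
  forall U, \dim U = k -> meets U -> cnt 0 U = B.

Lemma cone_count_missing U : ~~ meets U -> cnt 0 U = 0%N.
Proof.
move/existsPn=> nU; apply: big1 => w wU; rewrite add0r.
by have := nU w; rewrite wU /= => /negPf->.
Qed.

Lemma meetsS U W : (U <= W)%VS -> meets U -> meets W.
Proof.
move=> sUW /existsP[a /andP[aU Aa]]; apply/existsP; exists a.
by rewrite (subvP sUW).
Qed.

Lemma const_on_pred k B : (k.+1 < \dim {:fV})%N -> const_on k.+1 B ->
  exists B', const_on k B'.
Proof.
set n : nat := \dim _ => ltkn HB; pose Q := (q ^ (n - k) - 1)%N.
(* [Q] counts the nonzero vectors of the quotient by [W]. Summing over the spaces [W + <[x]>] gives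
   the linear equation [E3] for [cnt 0 W], whose other terms do not depend on [W]; the witness is
   its solution. It is unique because [k.+1 < n] makes [q - 1 < Q]. *)
exists ((Q * B - (q - 1) * cnt 0 fullv) %/ (Q - (q - 1)))%N => W dW mW.
have sW := subvf W.
have hx x : x \notin W -> (cnt 0 W + (q - 1) * cnt x W)%N = B.
  move=> xW; rewrite -cone_count_addl // HB ?dimv_addl ?dW //.
  exact: meetsS (addvSl _ _) mW.
have E1 := sum_cone_count_out sW.
have E2 : ((q - 1) * \sum_(v in {: fV}%VS | v \notin W) cnt v W
    + q ^ k * (Q * cnt 0 W) = q ^ k * (Q * B))%N.
  have QE : (q ^ k * Q = q ^ n - q ^ k)%N.
    by rewrite mulnBr muln1 -expnD subnKC // ltnW // ltnW.
  rewrite !mulnA QE -dW -!(sum_out_const _ sW) big_distrr /= -big_split /=.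
  by apply: eq_bigr => v /andP[_ /hx <-]; rewrite addnC.
have qk0 : (0 < q ^ k)%N by rewrite expn_gt0 ltnW ?q_gt1.
have E3 : ((q - 1) * cnt 0 fullv + Q * cnt 0 W = Q * B + (q - 1) * cnt 0 W)%N.
  apply/eqP; rewrite -(eqn_pmul2l qk0) !mulnDr -E2 addnAC eqn_add2r.
  by rewrite mulnCA -dW -E1 mulnDr mulnCA [(q ^ _ * (_ * _))%N]mulnCA.
have ltqQ : (q - 1 < Q)%N.
  rewrite ltn_sub2rE ?(ltnW q_gt1) // -{1}(expn1 q) ltn_exp2l ?q_gt1 //.
  by rewrite ltn_subRL addn1.
have -> : (Q * B - (q - 1) * cnt 0 fullv = (Q - (q - 1)) * cnt 0 W)%N.
  clearbody Q; move: E3 (leq_mul (ltnW ltqQ) (leqnn (cnt 0 W))).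
  rewrite [((Q - _) * _)%N]mulnBl.
  move: (Q * B)%N (Q * _)%N ((q - 1) * _)%N ((q - 1) * _)%N => *; lia.
by rewrite mulKn // subn_gt0.
Qed.

Lemma const_on_down k B : (2 <= k < \dim {:fV})%N -> const_on k B ->
  exists B', const_on 2 B'.
Proof.
elim: k B => [|k IHk] B /andP[// le2k ltkn] HB.
move: le2k; rewrite leq_eqVlt => /predU1P[k2|lt2k].
  by exists B; rewrite k2.
have [B' HB'] := const_on_pred ltkn HB; apply: (IHk B') => //.
by rewrite -ltnS lt2k ltnW.
Qed.

Lemma cone_neq0 v : A v -> v != 0.
Proof. by apply: contraTneq => ->. Qed.

(** [d] is one less than the number of points of the set on a line meeting it: the coset [x + <[a]>]
    represents each point of the line other than [<[a]>] once. *)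
Lemma cone_line_const B : const_on 2 B ->
  exists d, forall a x, A a -> x \notin <[a]>%VS -> cnt x <[a]> = d.
Proof.
move=> HB; exists ((B - (q - 1)) %/ (q - 1))%N => a x Aa xa.
have a0 : a != 0 by apply: contraTneq Aa => ->.
rewrite -(HB (<[a]> + <[x]>)%VS); last 2 first.
- by rewrite dimv_addl // dim_vline a0.
- apply: meetsS (addvSl _ _) _; apply/existsP; exists a.
  by rewrite memv_line Aa.
by rewrite cone_count_addl // cone_count_line // addKn mulKn // subn_gt0 q_gt1.
Qed.

(** * Sets meeting every line in 0 or [d + 1] points *)

Section LineConst.
Variable d : nat.
Hypothesis Hd : forall a x, A a -> x \notin <[a]>%VS -> cnt x <[a]> = d.

(** Sum over the cosets [v + <[a]>] with [v] in [U]: each [v] outside [<[a]>] contributes [d], each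
    of the [q] vectors inside contributes [q - 1]. *)
Lemma cone_count_sub a U : A a -> a \in U ->
  (q * cnt 0 U = (q ^ \dim U - q) * d + q * (q - 1))%N.
Proof.
move=> Aa aU; have sU : (<[a]> <= U)%VS by rewrite -memvE.
have a0 : a != 0 by apply: contraTneq Aa => ->.
have := sum_cone_count_out sU; rewrite dim_vline a0 expn1 => <-.
rewrite cone_count_line // (eq_bigr (fun=> d)) => [|v /andP[_ /(Hd Aa)//]].
by rewrite sum_out_const // dim_vline a0.
Qed.

Lemma const_on2 : const_on 2 ((q - 1) * d.+1).
Proof.
move=> U dU /existsP[a /andP[aU Aa]]; have := cone_count_sub Aa aU.
have q0 := ltnW q_gt1; rewrite dU => E; apply/eqP.
rewrite -(eqn_pmul2l q0) E; apply/eqP.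
have -> : (q ^ 2 - q = q * (q - 1))%N by rewrite mulnBr muln1.
by rewrite mulnS mulnDr mulnA addnC.
Qed.

Lemma const_on3 : const_on 3 ((q - 1) * (1 + d * (q + 1))).
Proof.
move=> U dU /existsP[a /andP[aU Aa]]; have := cone_count_sub Aa aU.
have q0 := ltnW q_gt1; rewrite dU => E; apply/eqP.
rewrite -(eqn_pmul2l q0) E; apply/eqP.
have -> : (q ^ 3 - q = q * (q - 1) * (q + 1))%N.
  by rewrite -mulnA -subn_sqr exp1n mulnBr muln1.
by rewrite [RHS]mulnA [RHS]mulnDr muln1 addnC [in RHS]mulnA mulnAC.
Qed.

(** Since [W] is external, [cnt x W] is the number of points of the set in [W + <[x]>], which is 0
    or [m]. *)
Lemma dvd_cone_count W x m : ~~ meets W -> x \notin W ->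
  const_on (\dim W).+1 ((q - 1) * m) -> (m %| cnt x W)%N.
Proof.
move=> nW xW Hm; have := cone_count_addl xW.
rewrite (cone_count_missing nW) add0n; case: (boolP (meets (W + <[x]>))) => mU.
  rewrite Hm ?dimv_addl // => /eqP; rewrite eqn_pmul2l ?subn_gt0 ?q_gt1 //.
  by move/eqP<-.
rewrite (cone_count_missing mU) => /esym/eqP;
  rewrite muln_eq0 subn_eq0 leqNgt q_gt1.
by move/eqP->; rewrite dvdn0.
Qed.

Lemma missing_line_exists a : A a -> (d.+1 < q)%N -> (2 < \dim {:fV})%N ->
  exists y v, [/\ y != 0, v \notin <[y]>%VS & ~~ meets (<[y]> + <[v]>)].
Proof.
move=> Aa ltdq n3; have a0 : a != 0 by apply: contraTneq Aa => ->.
have da : \dim <[a]> = 1%N by rewrite dim_vline a0.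
have /subvPn[x _ xa] : ~~ (fullv <= <[a]>)%VS.
  by apply/negP=> /dimvS; rewrite da leqNgt ltnW.
have [/existsP[w /andP[wa nA]]|/existsPn allA] :=
    boolP [exists w in <[a]>%VS, ~~ A (x + w)]; last first.
  have := Hd Aa xa; rewrite /cnt (eq_bigr (fun=> 1%N)) => [|w wa].
    by rewrite sum1_card card_vspace da expn1 => qd;
      rewrite qd ltnNge leqnSn in ltdq.
  by have := allA w; rewrite wa /= negbK => ->.
set y := x + w in nA.
have y0 : y != 0.
  by apply: contraNneq xa => xw; rewrite -(addrK w x) -/y xw sub0r rpredN.
have dy : \dim <[y]> = 1%N by rewrite dim_vline y0.
have ny : ~~ meets <[y]>.
  apply/existsPn=> z; apply/negP=> /andP[/vlineP[c ->]].
  by have [->|c0] := eqVneq c 0;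
    rewrite ?scale0r ?(negPf A0) // AZ // (negPf nA).
have [/existsP[v /andP[vy nv]]|/existsPn allM] :=
  boolP [exists v, (v \notin <[y]>%VS) && ~~ meets (<[y]> + <[v]>)];
    first by exists y, v.
(* If every line through the external point [<[y]>] met the set, each would contain [d.+1] of its
   points. Comparing with the count through [<[a]>] would force the whole space to have dimension
   2. *)
have := sum_cone_count_out (subvf <[y]>).
rewrite (cone_count_missing ny) muln0 addn0 dy expn1.
rewrite (cone_count_sub Aa (memvf a)) (eq_bigr (fun=> d.+1)) =>
    [|v /andP[_ vy]]; last first.
  have := allM v; rewrite vy negbK => mv.
  have := cone_count_addl vy;
    rewrite (cone_count_missing ny) add0n const_on2 ?dimv_addl ?dy //.
  by move/eqP; rewrite eqn_pmul2l ?subn_gt0 ?q_gt1 // => /eqP.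
rewrite sum_out_const ?subvf // dy expn1 mulnS addnC => /addnI/eqP.
have -> : (q * (q - 1) = q ^ 2 - q)%N by rewrite mulnBr muln1.
have : (q <= q ^ 2 < q ^ \dim {:fV})%N.
  by rewrite ltn_exp2l ?q_gt1 // n3 -{1}[q]expn1 leq_exp2l ?q_gt1.
by move: (q ^ \dim _)%N (q ^ 2)%N => an a2 /andP[? ?] ?; exfalso; lia.
Qed.

Lemma line_const_extreme a : prime_power q -> A a -> (3 < \dim {:fV})%N ->
  [\/ d = 0%N, (q <= d)%N | d.+1 = q].
Proof.
move=> q_pp Aa n4; have [->|d0] := posnP d; first by constructor 1.
have [ledq|ltqd] := leqP q d; first by constructor 2.
constructor 3; apply/eqP; rewrite eqn_leq ltqd leqNgt; apply/negP=> ltdq.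
have [y [v [y0 vy nM]]] := missing_line_exists Aa ltdq (ltnW n4).
set M := (_ + _)%VS in nM.
have dy : \dim <[y]> = 1%N by rewrite dim_vline y0.
have dM : \dim M = 2%N by rewrite dimv_addl ?dy.
have aM : a \notin M.
  by apply: contraNN nM => aM; apply/existsP; exists a; rewrite aM.
pose U := (M + <[a]>)%VS; have dU : \dim U = 3%N by rewrite dimv_addl ?dM.
have aU : a \in U by rewrite memvE addvSr.
have sMU : (M <= U)%VS by apply: addvSl.
have syM : (<[y]> <= M)%VS by apply: addvSl.
have ny : ~~ meets <[y]> by apply: contraNN nM; apply: meetsS.
have /subvPn[x _ xU] : ~~ (fullv <= U)%VS.
  by apply/negP=> /dimvS; rewrite dU leqNgt n4.
have [p [e [pp _ qE]]] := q_pp.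
have := @no_maximal_arc_type p e d pp d0; rewrite -qE => /(_ ltdq).
(* Cosets of [<[a]>] show that [x + U] contains [q ^ 2 * d] cone vectors. Cosets of the external
   line [M] split the same count into multiples of the arc size, each vector being counted [q ^ 2]
   times. *)
have -> : (1 + d * (q + 1) %| d * q ^ 4)%N.
  have a0 : a != 0 by apply: contraTneq Aa => ->.
  have saU : (<[a]> <= U)%VS by rewrite -memvE.
  have := sum_cone_count x saU; rewrite dim_vline a0 expn1.
  rewrite (eq_bigr (fun=> d)) => [|u uU]; last first.
    apply: Hd => //; apply: contraNN xU => /(subvP saU).
    by rewrite rpredDr.
  rewrite sum_nat_const card_vspace dU expnS -mulnA => /eqP.
  rewrite eqn_pmul2l ?(ltnW q_gt1) // => /eqP xUE.
  have := sum_cone_count x sMU; rewrite dM -xUE mulnA -expnD mulnC => <-.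
  apply: dvdn_sum => u uU; apply: dvd_cone_count => //.
    by apply: contraNN xU => /(subvP sMU); rewrite rpredDr.
  by rewrite dM; apply: const_on3.
move=> /(_ isT)/negP; apply.
(* Inside the plane [U], the arc size is [cnt a M]; the lines through the external point [<[y]>]
   split [q] times it into multiples of [d.+1]. *)
have -> : (1 + d * (q + 1))%N = cnt a M.
  have := cone_count_addl aM;
    rewrite (cone_count_missing nM) add0n const_on3 //.
    by move/eqP; rewrite eqn_pmul2l ?subn_gt0 ?q_gt1 // => /eqP.
  by apply/existsP; exists a; rewrite aU.
have := sum_cone_count a syM; rewrite dy expn1 => <-.
apply: dvdn_sum => u uM; apply: dvd_cone_count => //.
  by apply: contraNN aM => /(subvP syM); rewrite rpredDr.
by rewrite dy; apply: const_on2.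
Qed.

Variable a : fV.
Hypothesis Aa : A a.

Lemma line_const0 v : d = 0%N -> A v -> v \in <[a]>%VS.
Proof.
move=> d0 Av; apply: contraTT Av => /(Hd Aa); rewrite d0 => /eqP.
by rewrite sum_nat_eq0 => /forallP/(_ 0); rewrite mem0v addr0 implyTb eqb0.
Qed.

Lemma mem_line_cone b v : A b -> v \in <[b]>%VS -> v != 0 -> A v.
Proof.
move=> Ab /vlineP[c ->] c0; rewrite AZ //.
by apply: contraNneq c0 => ->; rewrite scale0r.
Qed.

Lemma card_line_compl b x : A b -> x \notin <[b]>%VS ->
  (d + #|[pred w in <[b]>%VS | ~~ A (x + w)%R]| = q)%N.
Proof.
move=> Ab xb; rewrite -(Hd Ab xb) cone_count_compl dim_vline.
by rewrite cone_neq0 // expn1.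
Qed.

Lemma line_const_full v : (q <= d)%N -> v != 0 -> A v.
Proof.
move=> leqd v0; have [/(mem_line_cone Aa)->//|va] := boolP (v \in <[a]>%VS).
have E := card_line_compl Aa va.
have /card0_eq/(_ 0) : #|[pred w in <[a]>%VS | ~~ A (v + w)%R]| = 0%N by lia.
by rewrite !inE mem0v addr0 => /negbFE.
Qed.

(** Each coset [x + <[b]>] with [b] in the cone and [x] outside [<[b]>] now has exactly one vector
    outside the cone. Uniqueness makes the complement of the cone a subspace; existence makes it a
    hyperplane. *)
Lemma line_const_hyperplane : d.+1 = q ->
  exists H : {vspace fV},
    (\dim H).+1 = \dim {:fV} /\ forall v, (v \in H) = ~~ A v.
Proof.
move=> dq.
have one b x : A b -> x \notin <[b]>%VS ->
    #|[pred w in <[b]>%VS | ~~ A (x + w)%R]| = 1%N.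
  by move=> Ab xb; have := card_line_compl Ab xb; lia.
have addA u v : ~~ A u -> ~~ A v -> ~~ A (u + v).
  move=> nu nv; apply/negP=> Ab; have [ub|ub] := boolP (u \in <[u + v]>%VS).
    have [u0|/(mem_line_cone Ab ub)] := eqVneq u 0; last by rewrite (negPf nu).
    by rewrite u0 add0r (negPf nv) in Ab.
  have /eqP := one _ _ Ab ub; rewrite eqn_leq => /andP[/card_le1_eqP le1 _].
  have nAN w : A (- w) = A w by rewrite -scaleN1r AZ // oppr_eq0 oner_eq0.
  (* Both [u] and [u - (u + v) = - v] lie in the coset [u + <[u + v]>] and outside the cone, so they
     coincide. *)
  suff E : 0 = - (u + v).
    by have := cone_neq0 Ab; rewrite -oppr_eq0 -E eqxx.
  apply: le1; first by rewrite inE rpredN memv_line opprD addNKr nAN nv.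
  by rewrite inE mem0v addr0 nu.
pose H : {vspace fV} := (\sum_(v : fV | ~~ A v) <[v]>)%VS.
have mH v : (v \in H) = ~~ A v.
  apply/idP/idP=> [/memv_sumP[vs Hvs ->]|nv]; last first.
    by rewrite memvE (sumv_sup v).
  elim/big_ind: _ => // u nu; have /vlineP[c ->] := Hvs u nu.
  by have [->|c0] := eqVneq c 0; rewrite ?scale0r // AZ.
exists H; split=> //.
have aH : a \notin H by rewrite mH Aa.
rewrite -(dimv_addl aH); congr (\dim _); apply/eqP; rewrite eqEsubv subvf.
apply/subvP=> x _; have [xa|xa] := boolP (x \in <[a]>%VS).
  by rewrite (subvP (addvSr _ _)).
have : (0 < #|[pred w in <[a]>%VS | ~~ A (x + w)%R]|)%N by rewrite one.
case/card_gt0P=> w /andP[wa nA]; rewrite -(addrK w x).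
by rewrite memv_add ?mH ?rpredN.
Qed.
End LineConst.

End ConeCounting.

(** * Point sets *)

Section PointSets.
Variables (F : finFieldType) (V : vectType F).
Local Notation fV := (finvect_type V).
Local Notation q := #|F|.
Implicit Types (P : {set {vspace fV}}) (U : {vspace fV}).

Definition cone P (v : fV) : bool := <[v]>%VS \in P.

Lemma vlineZ s (v : fV) : s != 0 -> <[s *: v]>%VS = <[v]>%VS.
Proof.
move=> s0; apply/eqP; rewrite eqEsubv -!memvE memvZ ?memv_line //=.
by rewrite -{1}(scalerK s0 v) memvZ ?memv_line.
Qed.

Lemma pg_pointP (p : {vspace fV}) :
  reflect (exists2 v : fV, v != 0 & p = <[v]>%VS) (p \in pg_points fV).
Proof.
rewrite inE; apply: (iffP eqP) => [dp|[v v0 ->]]; last by rewrite dim_vline v0.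
have v0 : vpick p != 0 by rewrite vpick0 -dimv_eq0 dp.
exists (vpick p) => //; apply/esym/eqP.
by rewrite eqEdim -memvE memv_pick dp dim_vline v0.
Qed.

Lemma vline_mem_point (p : {vspace fV}) (v : fV) : p \in pg_points fV ->
  (<[v]>%VS == p) = (v != 0) && (v \in p).
Proof.
rewrite inE => /eqP dp; apply/eqP/andP=> [vE|[v0 vp]].
  by rewrite -[v != 0]eqb1 -dim_vline vE dp -vE memv_line.
by apply/eqP; rewrite eqEdim -memvE vp dp dim_vline v0.
Qed.

Lemma cone0 P : P \subset pg_points fV -> ~~ cone P 0.
Proof.
move=> sP; apply/negP=> /(subsetP sP); rewrite inE dim_vline.
by rewrite eqxx.
Qed.

Lemma coneZ P s v : s != 0 -> cone P (s *: v) = cone P v.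
Proof. by move=> s0; rewrite /cone vlineZ. Qed.

Lemma cone_count_points P U : P \subset pg_points fV ->
  cone_count (cone P) 0 U = ((q - 1) * #|P :&: points_of U|)%N.
Proof.
move=> sP; rewrite /cone_count -big_mkcondr /=.
rewrite (eq_bigl (fun v : fV => (v \in U) && cone P v)); last first.
  by move=> v; rewrite add0r.
rewrite (partition_big (fun v : fV => <[v]>%VS) (mem (P :&: points_of U))) /=;
  last first.
  move=> v /andP[vU vP]; rewrite !inE -memvE vU andbT; apply/andP; split=> //.
  by have := subsetP sP _ vP; rewrite inE.
rewrite mulnC -sum_nat_const; apply: eq_bigr => p;
  rewrite !inE => /and3P[pP /eqP dp pU].
have pp : p \in pg_points fV by rewrite inE dp.
rewrite sum1dep_card -[RHS](_ : #|(p : {vspace fV})|.-1 = _); last first.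
  by rewrite card_vspace dp expn1 subn1.
rewrite [in RHS](cardD1 0) mem0v add1n /=; apply: eq_card => v.
rewrite !inE vline_mem_point //; apply: andb_idl => /andP[v0 vp].
have /eqP vE : <[v]>%VS == p by rewrite vline_mem_point // v0.
by rewrite (subvP pU) //= /cone vE.
Qed.

Lemma card_points_of U : ((q - 1) * #|points_of U| = q ^ \dim U - 1)%N.
Proof.
have <- : pg_points fV :&: points_of U = points_of U.
  by apply/setIidPr/subsetP=> p; rewrite inE => /andP[].
rewrite -cone_count_points // /cone_count -big_mkcondr /= sum1dep_card.
rewrite -card_vspace [in RHS](cardD1 0) mem0v addKn; apply: eq_card => v.
by rewrite !inE add0r /cone inE dim_vline eqb1 andbC.
Qed.

Lemma meets_coneP P U : P \subset pg_points fV ->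
  meets (cone P) U = (P :&: points_of U != set0).
Proof.
move=> sP; apply/existsP/set0Pn => [[v /andP[vU vP]]|[p]].
  by exists <[v]>%VS; have := subsetP sP _ vP; rewrite !inE -memvE vU => ->;
    rewrite !andbT.
rewrite inE => /andP[pP]; rewrite inE => /andP[/pg_pointP[v v0 pE] pU].
by exists v; rewrite memvE -pE pU /cone -pE.
Qed.

Lemma two_valued_classify k B P : prime_power q ->
    (2 <= k < \dim {:fV})%N -> (3 < \dim {:fV})%N ->
    P \subset pg_points fV -> P != set0 -> P != pg_points fV ->
    (forall U, \dim U = k -> P :&: points_of U != set0 ->
        #|P :&: points_of U| = B) ->
  (exists2 p, p \in pg_points fV & P = [set p]) \/
  (exists2 H, hyperplane H & P = pg_points fV :\: points_of H).
Proof.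
move=> q_pp kn n4 sP P0 PT HB.
have A0 := cone0 sP; have AZ := @coneZ P.
have [p pP] := set0Pn _ P0; have pp := subsetP sP p pP.
have [a a0 pE] := pg_pointP _ pp.
have Aa : cone P a by rewrite /cone -pE.
have [|B2 HB2] := const_on_down A0 AZ (B := ((q - 1) * B)%N) kn.
  by move=> U dU mU; rewrite cone_count_points // HB // -meets_coneP.
have [d Hd] := cone_line_const A0 AZ HB2.
have [d0|leqd|dq] := line_const_extreme A0 AZ Hd q_pp Aa n4.
- left; exists p => //; apply/setP=> r; rewrite inE; apply/idP/eqP=> [rP|->//].
  have [v v0 rE] := pg_pointP _ (subsetP sP r rP).
  have vP : cone P v by rewrite /cone -rE.
  apply/eqP; rewrite rE pE vline_mem_point -?pE // v0 pE.
  exact: (line_const0 Hd Aa d0 vP).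
- case/eqP: PT; apply/eqP; rewrite eqEsubset sP;
  apply/subsetP=> r /pg_pointP[v v0 ->].
  exact: (line_const_full A0 AZ Hd Aa leqd v0).
right; have [H [dH HH]] := line_const_hyperplane A0 AZ Hd Aa dq.
exists H; first exact/eqP.
apply/setP=> r; rewrite in_setD [r \in points_of H]inE.
have [/pg_pointP[v v0 ->]|/negPf rn] := boolP (r \in pg_points fV); last first.
  by rewrite andbF; apply/negP=> /(subsetP sP); rewrite rn.
by rewrite andbT -memvE (HH v) negbK.
Qed.

Lemma type_missing_classify k alpha beta P U0 : prime_power q ->
    (2 <= k < \dim {:fV})%N -> (3 < \dim {:fV})%N ->
    set_of_type k alpha beta P -> P != set0 -> P != pg_points fV ->
    \dim U0 = k -> P :&: points_of U0 = set0 ->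
  alpha = 0 /\
  ((exists2 p, p \in pg_points fV & P = [set p]) \/
   (exists2 H, hyperplane H & P = pg_points fV :\: points_of H)).
Proof.
move=> q_pp kn n4 [ltab sP Hab] P0 PT dU0 PU0.
have /andP[k2 ltkn] := kn.
have alpha0 : alpha = 0.
  (* If [beta] were 0, then [alpha] would be negative and every k-space would miss [P], including
     one through a point of [P]. *)
  have := Hab U0 dU0; rewrite PU0 cards0 => -[//|b0].
  have [p pP] := set0Pn _ P0.
  have /pg_pointP[v v0 pE] := subsetP sP p pP.
  have [|U [pU _ dU]] := @vspace_extend F V p fullv k (subvf _).
    by have := subsetP sP p pP; rewrite inE => /eqP->; rewrite ltnW // ltnW.
  have pPU : p \in P :&: points_of U.
    by have := subsetP sP p pP; rewrite !inE pP pU => ->.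
  have : (0 < #|P :&: points_of U|)%N by apply/card_gt0P; exists p.
  by case: (Hab U dU) => E; lia.
split=> //; apply: (@two_valued_classify k `|beta|%N) => // U dU.
rewrite -card_gt0; case: (Hab U dU); lia.
Qed.

Lemma set_of_typeC k alpha beta P : set_of_type k alpha beta P ->
  let full := Posz ((q ^ k - 1) %/ (q - 1)) in
  set_of_type k (full - beta) (full - alpha) (pg_points fV :\: P).
Proof.
move=> [ltab sP Hab] full; split.
- by rewrite Num.Theory.ltrD2l Num.Theory.ltrN2.
- exact: subsetDl.
move=> U dU; have -> : (pg_points fV :\: P) :&: points_of U = points_of U :\: P.
  by apply/setP=> p; rewrite !inE; case: (p \in P);
    rewrite ?andbF //= andbA andbb.
have -> : full = #|points_of U|.
  by rewrite /full -dU -card_points_of mulKn // subn_gt0 finNzRing_gt1.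
have := cardsID P (points_of U); rewrite setIC => <-.
by case: (Hab U dU) => <-; [right|left]; rewrite PoszD addrAC subrr add0r.
Qed.

End PointSets.

(** The symmetric case of [point_ramsey], with coordinates taken in a basis of [V]; the bound
    depends on [q] and [k] only. *)
Lemma homogeneous_subspace (q k : nat) : exists N : nat,
  forall (F : finFieldType) (V : vectType F) (A : V -> bool),
    #|F| = q -> (N <= \dim {:V})%N ->
    (forall s v, s != 0 -> A (s *: v) = A v) ->
  exists b (U : {vspace V}),
    \dim U = k /\ forall v, v \in U -> v != 0 -> A v = b.
Proof.
have [N HN] := point_ramsey q (fun=> k); exists N => F V A cF leN AZ.
pose e := vbasis {: V}; have be : basis_of {: V} e := vbasisP _.
have [s w s0|b [M [fM HM]]] := HN F _ (fun w => A (vecof e w)) cF leN.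
  by rewrite linearZ AZ.
pose f := linfun (vecof e \o mulmxr M).
have fE w : f w = vecof e (w *m M) by rewrite lfunE.
exists b, (limg f); split=> [|v /memv_imgP[w _ ->]].
  have kf : (fullv :&: lker f)%VS = 0%VS.
    apply/eqP; rewrite -subv0; apply/subvP=> w /memv_capP[_].
    by rewrite memv_ker fE memv0 vecof_eq0 // mulmx_free_eq0.
  by rewrite limg_dim_eq // dimvf dim_matrix mul1r.
rewrite fE => v0; apply: HM; apply: contraNneq v0 => ->.
by rewrite mul0mx linear0.
Qed.

(* [finvect_type V] is [V] only up to eta-expansion of the structure, hence not
   by conversion when [V] is a variable. *)
Lemma finvect_typeE (F : finFieldType) (V : vectType F) :
  (finvect_type V : vectType F) = V.
Proof. by case: V => S []. Qed.

Theorem theorem14 (q k : nat) (hq : prime_power q) (hk : (2 <= k)%N) :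
  exists n0 : nat, forall n : nat, (n0 <= n)%N ->
  forall (F : finFieldType) (V : vectType F),
    #|F| = q -> \dim {:V} = n ->
  forall (alpha beta : int) (P : {set {vspace V}}),
    set_of_type k alpha beta P ->
    P <> set0 -> P <> pg_points V ->
    (alpha = Posz 0 \/ beta = Posz ((q ^ k - 1) %/ (q - 1))) /\
    [\/ exists2 p, p \in pg_points V & P = [set p],
        exists2 H, hyperplane H & P = points_of H,
        exists2 p, p \in pg_points V & P = pg_points V :\: [set p]
      | exists2 H, hyperplane H & P = pg_points V :\: points_of H].
Proof.
have [N HN] := homogeneous_subspace q k.
(* [N] serves the Ramsey step, [k.+1] the descent to lines, and 4 leaves room for a vector outside a
   plane. *)
exists (maxn N (maxn k.+1 4)) => n; rewrite !geq_max => /and3P[leN ltkn n4].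
move=> F V'; rewrite -(finvect_typeE V'); set V := finvect_type V'.
move=> cF dV alpha beta P HP /eqP P0 /eqP PT; have [_ sP _] := HP.
have [|b [U [dU HU]]] := HN F V (cone P) cF _ (coneZ P); first by rewrite dV.
rewrite -cF in hq *; have kn : (2 <= k < \dim {: V})%N by rewrite hk dV.
have n4' : (3 < \dim {: V})%N by rewrite dV.
have PDK : pg_points V :\: (pg_points V :\: P) = P.
  by rewrite setDDr setDv set0U; apply/setIidPr.
(* If all points of [U] are in [P], the complement of [P] misses [U] and is classified instead. Its
   lower value is the number of points of a k-space minus [beta], so its vanishing determines
   [beta]. *)
case: b HU => HU.
  have PC := set_of_typeC HP.
  have [] := type_missing_classify hq kn n4' PC _ _ dU.
  - by rewrite setD_eq0; apply: contraNN PT; rewrite eqEsubset sP.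
  - by apply: contraNneq P0 => E; rewrite -PDK E setDv.
  - apply/setP=> p; rewrite !inE; apply/negP=> /andP[/andP[pP pp] /andP[_ pU]].
    case/negP: pP; have /pg_pointP[v v0 pE] : p \in pg_points V by rewrite inE.
    by rewrite pE; apply: (HU v) => //; rewrite memvE -pE.
  move=> /eqP; rewrite subr_eq0 => /eqP <- cls; split; first by right.
  case: cls => -[H hH E]; [constructor 3|constructor 2]; exists H;
    rewrite // -?E ?PDK //.
  rewrite -PDK E setDDr setDv set0U; apply/setIidPr.
  by apply/subsetP=> p; rewrite inE => /andP[].
have [] := type_missing_classify hq kn n4' HP P0 PT dU.
  apply/setP=> p; rewrite !inE; apply/negP=> /andP[pP /andP[pp pU]].
  have /pg_pointP[v v0 pE] : p \in pg_points V by rewrite inE.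
  by have := HU v; rewrite memvE -pE v0 pU /cone -pE pP => /(_ isT isT).
move=> -> [|] cls; split; first [by left | by constructor 1 | by constructor 4].
Qed.
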